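(* Let the deletion distribution $\mu$ be the uniform distribution over the points of $S$, $|S|=T$, and let $\mathsf{Alg}$ be the BBQSampler-based algorithm defined in the context, with sampling parameter $\kappa\in(0,1)$ and core set deletion capacity $K\ge 1$. Then for $c>0$, $\mathsf{Alg}$ can process a total of $$K_{\mathrm{total}}=\frac{c\cdot K\cdot T}{d\,T^{\kappa}\log T}$$ deletions while ensuring that the probability of exhausting the core set deletion capacity $K$ is at most $c$; that is, for this $K_{\mathrm{total}}$, $\Pr_{S,\pi,\sigma}(K_{\mathrm{csd}}>K)\le c$, where $K_{\mathrm{csd}}$ is the number of core set deletions among the first $K_{\mathrm{total}}$ deletion requests.
   Context: $S$ is a random dataset with points $x_1,\dots,x_T\in\mathbb R^d$, $\|x_t\|\le1$, labels $y_t\in\{\pm1\}$. $\pi$ is a uniformly random permutation of the samples of $S$; the algorithm is run on $\pi(S)$. $\sigma$ is a sequence of deletion requests drawn without replacement from $\mu$ (here uniform over $S$), independent of $\pi$ given $S$. A core set deletion is a request for a point in the core set obtained on $\pi(S)$. $K_{\mathrm{total}}$ is read as an integer number of requests. BBQSampler with parameters $K,\kappa$ on an ordered dataset of size $T$: $A_0=\lambda I$ with $\lambda=K$; at step $t$, if the current point $x$ satisfies $x^\top A_{t-1}^{-1}x>T^{-\kappa}$, the point is queried and $A_t=A_{t-1}+xx^\top$; otherwise $A_t=A_{t-1}$. The core set is the set of queried points, and the model of $\mathsf{Alg}$ is $x\mapsto\mathrm{sign}(w^\top x)$ with $w=A_T^{-1}\sum y_tx_t$ (sum over queried points). *)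

(* Defs.v *)
From HB Require Import structures.
From mathcomp Require Import all_boot all_order all_algebra all_fingroup.
From mathcomp Require Import all_classical all_reals all_analysis.

Set Implicit Arguments.
Unset Strict Implicit.
Unset Printing Implicit Defensive.

Import Order.TTheory GRing.Theory Num.Theory.
Import numFieldNormedType.Exports.

Local Open Scope classical_set_scope.
Local Open Scope ring_scope.

(* Tuples rather than column vectors: they carry the product sigma-algebra
   needed to speak of a random dataset. *)
Definition sample (R : realType) (d : nat) := (d.-tuple R * R)%type.
Definition dataset (R : realType) (d T : nat) := (T.-tuple (d.-tuple R * R))%type.

Section Samples.
Context {R : realType} {d T : nat}.

Definition point (s : sample R d) : 'cV[R]_d := \col_i tnth s.1 i.
Definition label (s : sample R d) : R := s.2.

(* The norm that MathComp puts on matrices is the sup norm. *)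
Definition l2norm (x : 'cV[R]_d) : R := Num.sqrt (\sum_i x i 0 ^+ 2).

Definition valid_dataset (z : dataset R d T) : Prop :=
  forall t : 'I_T, l2norm (point (tnth z t)) <= 1 /\
    (label (tnth z t) = 1 \/ label (tnth z t) = -1).

Definition permute (p : 'S_T) (z : dataset R d T) : dataset R d T :=
  [tuple tnth z (p t) | t < T].

End Samples.

Section BBQSampler.
Context {R : realType} {d T : nat}.
Variables (K : nat) (kappa : R) (z : dataset R d T).

(* State: the current matrix and the set of positions queried so far. *)
Definition bbq_step (st : 'M[R]_d * {set 'I_T}) (t : 'I_T) :
    'M[R]_d * {set 'I_T} :=
  let x := point (tnth z t) in
  if T%:R `^ (- kappa) < (x^T *m invmx st.1 *m x) 0 0
  then (st.1 + x *m x^T, t |: st.2)%SET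
  else st.

Definition bbq_run : 'M[R]_d * {set 'I_T} :=
  foldl bbq_step ((K%:R)%:M, finset.set0) (enum 'I_T).

Record bbq_output := BBQOutput {
  core_positions : {set 'I_T};
  model : 'cV[R]_d -> R }.

Definition bbq_alg : bbq_output :=
  let: (A, Q) := bbq_run in
  let w := invmx A *m \sum_(t in Q) label (tnth z t) *: point (tnth z t) in
  BBQOutput Q (fun x => Num.sg ((w^T *m x) 0 0)).

End BBQSampler.

(* Core set of the run on the dataset permuted by p, as a set of indices of the
   original dataset z: position t of the permuted dataset holds sample p t.
   Samples are identified by index, so repeated points remain distinct. *)
Definition core_set (R : realType) (d T K : nat) (kappa : R)
    (z : dataset R d T) (p : 'S_T) : {set 'I_T} :=
  [set p t | t in core_positions (bbq_alg K kappa (permute p z))]%SET.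

(* Request k deletes sample s k; requests stop once all T samples are deleted. *)
Definition core_deletions (R : realType) (d T K : nat) (kappa : R)
    (z : dataset R d T) (p s : 'S_T) (m : nat) : nat :=
  #|[set k : 'I_T | (k < m)%N && (s k \in core_set K kappa z p)]%SET|.

Definition total_deletions (R : realType) (d T K : nat) (kappa c : R) : nat :=
  Num.truncn (c * K%:R * T%:R / (d%:R * T%:R `^ kappa * ln T%:R)).

(* Probability that draws without replacement from mu, a distribution of full
   support, produce s 0, s 1, ... in this order: each draw follows mu
   conditioned on the indices not drawn yet. *)
Definition wor_prob (R : realType) (T : nat) (mu : 'I_T -> R) (s : 'S_T) : R :=
  \prod_(k < T) (mu (s k) / (1 - \sum_(j < T | (j < k)%N) mu (s j))).

Definition uniform_mass (R : realType) (T : nat) : 'I_T -> R :=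
  fun=> T%:R^-1.

Section Conditioning.
Context {disp dispV : measure_display} {Omega : measurableType disp}
  {V : measurableType dispV} {R : realType}.
Variables (P : probability Omega R) (S : Omega -> V).

(* k \o S is a version of the conditional probability P(E | S). *)
Definition is_cond_prob (E : set Omega) (k : V -> R) : Prop :=
  measurable_fun setT k /\
  forall B : set V, measurable B ->
    P (S @^-1` B `&` E) = (\int[P]_(w in S @^-1` B) (k (S w))%:E)%E.

Definition cond_law (I : finType) (X : Omega -> I) (q : I -> V -> R) : Prop :=
  forall i, measurable (X @^-1` [set i]) /\
    is_cond_prob (X @^-1` [set i]) (q i).

Definition cond_indep (I J : finType) (X : Omega -> I) (Y : Omega -> J) : Prop :=
  forall i j (f g : V -> R),
    is_cond_prob (X @^-1` [set i]) f -> is_cond_prob (Y @^-1` [set j]) g ->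
    is_cond_prob (X @^-1` [set i] `&` Y @^-1` [set j]) (fun v => f v * g v).

End Conditioning.

(* Main.v *)
Require Import Defs.
From HB Require Import structures.
From mathcomp Require Import all_boot all_order all_algebra all_fingroup.
From mathcomp Require Import all_classical all_reals all_analysis.
From mathcomp Require Import measurable_realfun ring lra zify.

(** Write [u = T ^ (- kappa)]. A queried point multiplies [\det A] by more than
    [1 + u], while Hadamard and AM-GM give [\det A <= (\tr A / d) ^ d]; hence
    [n] queries satisfy [n * ln (1 + u) <= d * ln (1 + n / (d * K))]. The first
    query forces [K * u < 1], so replacing [ln (1 + u)] by [u] costs at most a
    factor [(K + 1) / K], and the core set has at most
    [(K + 1) / K * d * T ^ kappa * ln T] points. A uniformly random request hits
    a given core set with probability [n / T], and Markov's inequality for the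
    event [K_csd >= K + 1] absorbs exactly that factor. *)

Set Implicit Arguments.
Unset Strict Implicit.
Unset Printing Implicit Defensive.

Import Order.TTheory GRing.Theory Num.Theory.
Import numFieldNormedType.Exports.

Local Open Scope classical_set_scope.
Local Open Scope ring_scope.

(** * Determinants of positive definite matrices *)

Definition posdef (R : realFieldType) n (A : 'M[R]_n) :=
  A^T = A /\ forall x : 'cV_n, x != 0 -> 0 < (x^T *m A *m x) 0 0.

(** The matrix determinant lemma. The bordered matrix [M] is made block triangular in two ways: a
    column operation clears [x^T] and leaves [A + x *m x^T], a row operation clears [x^T] and leaves
    the Schur complement of [A]. *)
Lemma det_rank1_update (R : fieldType) n (A : 'M[R]_n) (x : 'cV_n) :
  A \in unitmx ->
  \det (A + x *m x^T) = \det A * (1 + (x^T *m invmx A *m x) 0 0).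
Proof.
move=> Au; pose M : 'M[R]_(n + 1) := block_mx A (- x) x^T 1%:M.
have -> : \det (A + x *m x^T) = \det M.
  have -> : \det M = \det (M *m block_mx 1%:M 0 (- x^T) 1%:M).
    by rewrite det_mulmx det_lblock !det1 !mulr1.
  rewrite mulmx_block !mulmx1 !mulmx0 !mul1mx !add0r.
  by rewrite mulmxN mulNmx opprK subrr det_ublock det1 mulr1.
have -> : \det M = \det (block_mx 1%:M 0 (- x^T *m invmx A) 1%:M *m M).
  by rewrite det_mulmx det_lblock !det1 !mul1r.
rewrite mulmx_block !mul1mx !mul0mx !addr0 -mulmxA mulVmx // mulmx1 addNr.
rewrite det_ublock; congr (_ * _).
by rewrite det_mx11 mxE mulmxN !mulNmx opprK addrC [X in X + _]mxE.
Qed.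

Lemma posdef_diag_gt0 (R : realFieldType) n (A : 'M[R]_n) i :
  posdef A -> 0 < A i i.
Proof.
case=> _ /(_ (delta_mx i 0)); rewrite trmx_delta -rowE -colE !mxE; apply.
by apply/eqP => /matrixP /(_ i 0); rewrite !mxE !eqxx => /eqP; rewrite oner_eq0.
Qed.

(** One step of Gaussian elimination with pivot [A 0 0]. The Schur complement inherits positivity
    because its form at [x] is that of [A] at [x] extended by the first coordinate that minimises
    the form. *)
Lemma posdef_block (R : realFieldType) n (A : 'M[R]_(1 + n)) :
  posdef A ->
  let C' := drsubmx A - (A 0 0)^-1 *: (dlsubmx A *m (dlsubmx A)^T) in
  posdef C' /\ \det A = A 0 0 * \det C'.
Proof.
move=> pA C'; have a0 := posdef_diag_gt0 0 pA.
case: pA => As Apos; set a := A 0 0 in a0 C' *.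
set b := dlsubmx A in C' *; set C := drsubmx A in C' *.
have Eul : ulsubmx A = a%:M.
  apply/matrixP => i j; rewrite !ord1 !mxE eqxx mulr1n.
  by congr (A _ _); apply: val_inj.
have Eur : ursubmx A = b^T by rewrite /b -[in RHS]As trmx_dlsub trmxK.
have EC : C^T = C by rewrite /C -[in RHS]As trmx_drsub.
have EA : A = block_mx a%:M b^T b C by rewrite -[LHS]submxK Eul Eur.
split; [split|].
- by rewrite /C' linearB linearZ /= trmx_mul trmxK EC.
- move=> x x0; pose z : 'cV_(1 + n) := col_mx (- a^-1 *: (b^T *m x)) x.
  have /Apos : z != 0.
    apply: contra_neq x0 => z0.
    by rewrite -[x](@col_mxKd _ 1 _ _ (- a^-1 *: (b^T *m x))) -/z z0 linear0.
  suff -> : z^T *m A *m z = x^T *m C' *m x by [].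
  rewrite EA -mulmxA mul_block_col tr_col_mx mul_row_col.
  rewrite mul_scalar_mx scalerA mulrN divff ?gt_eqF // scaleN1r.
  rewrite addNr mulmx0 add0r.
  rewrite -scalemxAr /C' mulmxBr mulmxBl -scalemxAr -scalemxAl -!mulmxA.
  by rewrite mulmxDr -scalemxAr scaleNr addrC.
(* Left multiplication by the unipotent [E] clears the column below the pivot, leaving a block upper
   triangular matrix with diagonal blocks [a] and [C']. *)
pose E : 'M[R]_(1 + n) := block_mx 1%:M 0 (- a^-1 *: b) 1%:M.
have -> : \det A = \det (E *m A) by rewrite det_mulmx det_lblock !det1 !mul1r.
rewrite EA mulmx_block !mul1mx !mul0mx !addr0 mul_mx_scalar scalerA mulrN.
rewrite divff ?gt_eqF // scaleN1r addNr -/b.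
rewrite [LHS]det_ublock det_scalar1 -scalemxAl scaleNr addrC //.
Qed.

(* Hadamard's inequality, by induction on Schur complements. *)
Lemma det_le_prod_diag (R : realFieldType) n (A : 'M[R]_n) :
  posdef A -> \det A <= \prod_i A i i.
Proof.
elim: n A => [|n IH] A pA; first by rewrite det_mx00 big_ord0.
have a0 := posdef_diag_gt0 0 pA.
have [pC' ->] := @posdef_block R n A pA; rewrite big_ord_recl ler_pM2l //.
(* Passing to the Schur complement lowers each diagonal entry, by the square of an entry of the
   first column divided by the pivot. *)
apply: le_trans (IH _ pC') _; apply: ler_prod => i _.
rewrite (ltW (posdef_diag_gt0 i pC')) /=.
rewrite [_ *: _]lock !mxE -lock.
have -> : rshift 1 i = lift ord0 i by apply: val_inj.
rewrite gerBl mxE mulr_ge0 ?invr_ge0 ?(ltW a0) //.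
by rewrite mxE big_ord1 [_^T _ _]mxE -expr2 sqr_ge0.
Qed.

Lemma posdef_det_le_mxtrace (R : realFieldType) n (A : 'M[R]_n) :
  posdef A -> \det A <= (\tr A / n%:R) ^+ n.
Proof.
move=> pA; apply: le_trans (det_le_prod_diag pA) _.
have := (leif_AGM (A := 'I_n) (E := fun i => A i i)).
rewrite card_ord => /(_ _)/leifP.
move=> H; have /H : {in 'I_n, forall i, 0 <= A i i}.
  by move=> i _; exact/ltW/posdef_diag_gt0.
by case: ifP => _ => [/eqP -> //|/ltW].
Qed.

(** * Invariant of the sampling run *)

(** The Loewner order between [L * I] and [A]. *)
Definition dominates (R : realFieldType) n (L : R) (A : 'M[R]_n) :=
  forall y : 'cV_n, L * (y^T *m y) 0 0 <= (y^T *m A *m y) 0 0.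

Lemma sqnormE (R : realFieldType) n (y : 'cV[R]_n) :
  (y^T *m y) 0 0 = \sum_i y i 0 ^+ 2.
Proof. by rewrite mxE; apply: eq_bigr => i _; rewrite mxE expr2. Qed.

Lemma dominates_posdef (R : realFieldType) n (L : R) (A : 'M[R]_n) :
  0 < L -> A^T = A -> dominates L A -> posdef A.
Proof.
move=> L0 As dA; split => // x x0; apply: lt_le_trans (dA x).
rewrite mulr_gt0 // sqnormE lt_neqAle sumr_ge0 ?andbT; last first.
  by move=> *; exact: sqr_ge0.
apply: contra_neq x0 => /esym /eqP.
rewrite psumr_eq0; last by move=> *; exact: sqr_ge0.
move=> /allP x0; apply/matrixP => i j; rewrite !ord1 mxE.
by apply/eqP; have := x0 i (mem_index_enum _); rewrite /= sqrf_eq0.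
Qed.

Lemma posdef_unitmx (R : realFieldType) n (A : 'M[R]_n) :
  posdef A -> A \in unitmx.
Proof.
case=> _ Apos; rewrite unitmxE unitfE; apply/det0P => -[v v0 vA0].
have /Apos : v^T != 0 by rewrite trmx_eq0.
by rewrite trmxK vA0 mul0mx mxE ltxx.
Qed.

(** No diagonalisation is involved: put [y = invmx A *m x], [r = x^T y = y^T A y] and [N = y^T y].
    Then [L * N <= r] by domination, and expanding [|x - L y|^2 >= 0] gives
    [|x|^2 >= 2 L r - L^2 N >= L r]. *)
Lemma dominates_invmx (R : realFieldType) n (L : R) (A : 'M[R]_n) (x : 'cV_n) :
  0 < L -> A^T = A -> dominates L A ->
  L * (x^T *m invmx A *m x) 0 0 <= (x^T *m x) 0 0.
Proof.
move=> L0 As dA.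
have Au := posdef_unitmx (dominates_posdef L0 As dA).
pose y := invmx A *m x.
have Ex : x = A *m y by rewrite /y mulmxA mulmxV // mul1mx.
have -> : x^T *m invmx A *m x = x^T *m y by rewrite mulmxA.
have Er : (x^T *m y) 0 0 = (y^T *m A *m y) 0 0.
  by rewrite [in LHS]Ex trmx_mul As.
have Eyx : (y^T *m x) 0 0 = (x^T *m y) 0 0.
  by rewrite [in LHS]Ex mulmxA Er.
have := dA y; rewrite -Er; set r := (x^T *m y) 0 0 in Er Eyx *.
set N := (y^T *m y) 0 0 => LN.
have : 0 <= ((x - L *: y)^T *m (x - L *: y)) 0 0.
  by rewrite sqnormE sumr_ge0 // => *; exact: sqr_ge0.
have -> : ((x - L *: y)^T *m (x - L *: y)) 0 0 =
    (x^T *m x) 0 0 - L * r - (L * r - L * (L * N)).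
  rewrite mulmxBr -!scalemxAr [_^T]linearB /= [(L *: y)^T]linearZ /=.
  rewrite !mulmxBl -!scalemxAl.
  move: Eyx; rewrite /r /N.
  move: (x^T *m x) (x^T *m y) (y^T *m x) (y^T *m y) => a b e f Eyx.
  rewrite !mxE Eyx; ring.
have : L * (L * N) <= L * r by rewrite ler_pM2l.
lra.
Qed.

(** A one by one matrix is its own determinant, so the bound is an equality; it lets [\det A]
    replace [L] in [dominates_invmx]. *)
Lemma det_dominates1 (R : realFieldType) n (A : 'M[R]_n) :
  n = 1%N -> dominates (\det A) A.
Proof.
move=> n1; subst n => y.
by rewrite !mxE !big_ord1 det_mx11 !mxE big_ord1 !mxE mulrCA mulrA.
Qed.

(* The last field records that in dimension one the n-th query met a matrix
   that was already at least [L * (1 + u) ^+ n.-1]. *)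
Record query_invariant (R : realFieldType) d (L u : R) (A : 'M[R]_d) (n : nat)
  :=
  QueryInvariant {
  qi_sym : A^T = A;
  qi_dominates : dominates L A;
  qi_tr : \tr A <= d%:R * L + n%:R;
  qi_det : L ^+ d * (1 + u) ^+ n <= \det A;
  qi_first : (0 < n)%N -> L * u < 1;
  qi_last : (0 < n)%N -> d = 1%N -> u * (L * (1 + u) ^+ n.-1) < 1 }.

Lemma query_invariant0 (R : realFieldType) d (L u : R) :
  query_invariant L u (L%:M : 'M[R]_d) 0.
Proof.
split=> //.
- exact: tr_scalar_mx.
- by move=> y; rewrite mul_mx_scalar -scalemxAl [leRHS]mxE.
- by rewrite mxtrace_scalar addr0 mulr_natl.
- by rewrite det_scalar expr0 mulr1.
Qed.

Lemma query_invariant_step (R : realFieldType) d (L u : R) (A : 'M[R]_d) n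
    (x : 'cV_d) :
  0 < L -> 0 < u -> (x^T *m x) 0 0 <= 1 -> u < (x^T *m invmx A *m x) 0 0 ->
  query_invariant L u A n -> query_invariant L u (A + x *m x^T) n.+1.
Proof.
move=> L0 u0 x1 ux [As dA trA detA _ _].
have Au := posdef_unitmx (dominates_posdef L0 As dA).
have det0 : 0 < \det A.
  by apply: lt_le_trans detA; rewrite mulr_gt0 ?exprn_gt0 // addr_gt0.
split.
- by rewrite linearD /= trmx_mul trmxK As.
- move=> y; apply: le_trans (dA y) _.
  rewrite mulmxDr mulmxDl [leRHS]mxE lerDl.
  have -> : y^T *m (x *m x^T) *m y = (x^T *m y)^T *m (x^T *m y).
    by rewrite trmx_mul trmxK !mulmxA.
  by rewrite mxE big_ord1 mxE -expr2 sqr_ge0.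
- rewrite linearD /= -natr1 addrA lerD //.
  by rewrite mxtrace_mulC /mxtrace big_ord1.
- rewrite det_rank1_update // exprSr mulrA ler_pM //.
  + by rewrite mulr_ge0 ?exprn_ge0 ?addr_ge0 // ltW.
  + by rewrite addr_ge0 // ltW.
  + by rewrite lerD2l ltW.
- move=> _; apply: lt_le_trans (le_trans (dominates_invmx x L0 As dA) x1).
  by rewrite ltr_pM2l.
- move=> _ d1 /=.
  (* The previous determinant, at least [L * (1 + u) ^+ n], now plays the role that [L] plays for
     [qi_first]. *)
  have dA' := det_dominates1 A d1.
  apply: lt_le_trans (le_trans (dominates_invmx x det0 As dA') x1).
  apply: le_lt_trans (_ : u * \det A < _); last by rewrite mulrC ltr_pM2l.
  have E : L = L ^+ d by rewrite [in RHS]d1 expr1.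
  by rewrite ler_pM2l // [X in X * _]E.
Qed.

Lemma bbq_run_invariant (R : realType) d T K (kappa : R) (z : dataset R d T) :
  (0 < K)%N -> (0 < T)%N -> valid_dataset z ->
  let: (A, Q) := bbq_run K kappa z in
  query_invariant K%:R (T%:R `^ (- kappa)) A #|Q|.
Proof.
move=> K0 T0 zv; rewrite /bbq_run.
have u0 : 0 < T%:R `^ (- kappa) :> R by rewrite powR_gt0 // ltr0n.
(* The induction carries that the remaining positions are distinct and outside the queried set, so
   that each query raises [#|Q|] by exactly one. *)
have : uniq (enum 'I_T) := enum_uniq _.
have : {in enum 'I_T, forall t, t \notin (finset.set0 : {set 'I_T})}.
  by move=> t _; rewrite inE.
have : query_invariant K%:R (T%:R `^ (- kappa)) (K%:R%:M : 'M[R]_d)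
    #|(finset.set0 : {set 'I_T})|.
  by rewrite cards0; exact: query_invariant0.
elim: (enum 'I_T) (K%:R%:M : 'M[R]_d) (finset.set0 : {set 'I_T}) => //= t s IH.
move=> A Q inv disj /andP[ts us].
rewrite {2}/bbq_step /=; case: ifPn => [ux|_]; last first.
  by apply: IH => // t' t's; apply: disj; rewrite inE t's orbT.
apply: IH => //.
- rewrite cardsU1 disj ?mem_head // add1n; apply: query_invariant_step => //.
    by rewrite ltr0n.
  have [+ _] := zv t; rewrite /l2norm -sqnormE => x1.
  rewrite -sqrtr1 ler_sqrt in x1 => //; by rewrite ler01.
- move=> t' t's; rewrite !inE negb_or disj ?inE ?t's ?orbT // andbT.
  by apply: contraNneq ts => <-.
Qed.

(** * Size of the core set *)

(** Since [2 * u / (2 + u) = 2 - 4 / (2 + u)], the claim is [f 0 <= f u], and the derivative of [f]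
    is [x ^+ 2 / ((1 + x) * (2 + x) ^+ 2)]. *)
Lemma ln1D_ge (R : realType) (u : R) : 0 <= u -> 2 * u / (2 + u) <= ln (1 + u).
Proof.
move=> u0; pose f (x : R) := ln (1 + x) + 4 * (2 + x)^-1.
have df (x : R) : 0 <= x -> is_derive x 1 f ((1 + x)^-1 - 4 / (2 + x) ^+ 2).
  move=> x0.
  have d1 : is_derive x 1 (fun y : R => ln (1 + y)) (1 + x)^-1.
    have x1 : 0 < 1 + x by lra.
    have dx : is_derive x 1 (fun y : R => 1 + y) 1.
      by apply: is_derive_eq; rewrite add0r mulr1.
    by have := is_derive1_comp (is_derive1_ln x1) dx; rewrite mulr1.
  have d2 : is_derive x 1 (fun y : R => (2 + y)^-1) (- (2 + x) ^- 2).
    have x2 : 2 + x != 0 by lra.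
    have dx : is_derive x 1 (fun y : R => 2 + y) 1.
      by apply: is_derive_eq; rewrite add0r mulr1.
    by have := is_deriveV x2 dx; rewrite [_ *: _]mulr1.
  rewrite /f; apply: is_derive_eq.
  by rewrite -[_ *: _]/(4 * _) mulrN.
suff : f 0 <= f u.
  rewrite /f !addr0 ln1 add0r => fu.
  have -> : 2 * u / (2 + u) = 4 * 2^-1 - 4 * (2 + u)^-1 by field; lra.
  lra.
apply: (@ger0_derive1_ndecr _ f 0 u) => //.
- by move=> x; rewrite in_itv /= => /andP[x0 _]; case: (df x (ltW x0)).
- move=> x; rewrite in_itv /= => /andP[x0 _].
  rewrite derive1E; case: (df x (ltW x0)) => _ ->.
  have -> : (1 + x)^-1 - 4 / (2 + x) ^+ 2 = x ^+ 2 / ((1 + x) * (2 + x) ^+ 2).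
    by field; rewrite ?mulf_neq0; lra.
  by rewrite divr_ge0 ?sqr_ge0 // mulr_ge0 ?sqr_ge0 //; lra.
- apply: derivable_within_continuous => x; rewrite in_itv /= => /andP[x0 _].
  by case: (df x x0).
Qed.

Lemma query_invariant_ln (R : realType) d (L u : R) (A : 'M[R]_d) n :
  (0 < d)%N -> 0 < L -> 0 < u -> query_invariant L u A n ->
  n%:R * ln (1 + u) <= d%:R * ln (1 + n%:R / (d%:R * L)).
Proof.
move=> d0 L0 u0 [As dA trA detA _ _].
have d0R : 0 < d%:R :> R by rewrite ltr0n.
have pA := dominates_posdef L0 As dA.
have n0 : 0 <= n%:R / (d%:R * L) by rewrite divr_ge0 ?mulr_ge0 // ltW.
have u1 : 0 < 1 + u by rewrite addr_gt0.
(* The two determinant bounds, [qi_det] from below and AM-GM with [qi_tr] from above, divided by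
   [L ^+ d]. *)
have H : (1 + u) ^+ n <= (1 + n%:R / (d%:R * L)) ^+ d.
  rewrite -(@ler_pM2l _ (L ^+ d)) ?exprn_gt0 // -exprMn.
  apply: le_trans detA (le_trans (posdef_det_le_mxtrace pA) _).
  have -> : L * (1 + n%:R / (d%:R * L)) = (d%:R * L + n%:R) / d%:R.
    by field; rewrite !gt_eqF.
  apply: lerXn2r; rewrite ?nnegrE ?ler_pM2r ?invr_gt0 //.
    by rewrite divr_ge0 ?ler0n // sumr_ge0 // => i _; exact/ltW/posdef_diag_gt0.
  by rewrite divr_ge0 ?ler0n // addr_ge0 ?mulr_ge0 ?ler0n // ltW.
have v1 : 0 < 1 + n%:R / (d%:R * L) by rewrite ltr_pwDl.
rewrite mulr_natl [leRHS]mulr_natl -!lnXn //.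
by rewrite ler_ln ?posrE ?exprn_gt0.
Qed.

(* The case [d = K = 1] with every point queried, where [1 + n / (d * K)]
   exceeds [T]. *)
Lemma all_queried_bound (R : realType) (T : nat) (u : R) :
  (1 < T)%N -> 0 < u -> T%:R^-1 < u -> u * (1 + u) ^+ T.-1 < 1 ->
  T%:R * u <= 2 * ln T%:R.
Proof.
move=> T1 u0 Tu uT.
have TR : 2 <= T%:R :> R by rewrite ler_nat.
have T1E : T.-1%:R = T%:R - 1 :> R by rewrite -subn1 natrB // ltnW.
have u1 : u * (1 + u) < 1.
  apply: le_lt_trans uT; rewrite ler_pM2l // -[leLHS]expr1.
  rewrite ler_weXn2l //; first lra.
  by lia.
(* At [u = 2 / 3] the product [u * (1 + u)] is already [10 / 9]. *)
have u23 : u <= 2 / 3 by nra.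
have lnu := ln1D_ge (ltW u0).
(* The general argument ends with [T <= 3 / 2 * (T - 1)], which needs [3 <= T]. For [T = 2] the
   bounds [u <= 2 / 3] and [ln 2 >= 2 / 3] are enough. *)
have [T2|T3] := eqVneq T 2%N.
  have ln2 : 2 / 3 <= ln 2 :> R.
    have := @ln1D_ge R 1 ler01; rewrite mulr1 (_ : 2 + 1 = 3 :> R) //.
    by rewrite -(natrD _ 2 1).
  rewrite T2; lra.
have {T3} TR3 : 3 <= T%:R :> R by rewrite ler_nat; lia.
have lnTu : T.-1%:R * ln (1 + u) <= ln T%:R.
  rewrite mulr_natl -lnXn; last lra.
  rewrite ler_ln ?posrE ?exprn_gt0; try lra.
  apply: ltW; rewrite -(ltr_pM2l u0); apply: lt_trans uT _.
  by rewrite -ltr_pdivrMr ?mul1r //; lra.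
(* The constant is the value of [2 / (2 + u)] at [u = 2 / 3]. *)
have lnu' : 3 / 4 * u <= ln (1 + u).
  apply: le_trans lnu; rewrite ler_pdivlMr; [nra|lra].
rewrite T1E in lnTu.
have : (T%:R - 1) * (3 / 4 * u) <= ln T%:R.
  by apply: le_trans lnTu; rewrite ler_pM2l //; lra.
nra.
Qed.

(** If [n <= d * K * (T - 1)], the logarithm in [query_invariant_ln] is at most [ln T]. Otherwise
    [n <= T] forces [d * K = 1] and [n = T], where the logarithm is slightly too large and [qi_last]
    takes over. *)
Lemma query_bound (R : realType) d (T K : nat) (u : R) (A : 'M[R]_d) n :
  (0 < d)%N -> (1 < T)%N -> (0 < K)%N -> 0 < u -> T%:R^-1 < u -> (n <= T)%N ->
  query_invariant K%:R u A n ->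
  K%:R * n%:R * u <= (K%:R + 1) * d%:R * ln T%:R.
Proof.
move=> d0 T1 K0 u0 Tu nT inv.
have dR : 0 < d%:R :> R by rewrite ltr0n.
have KR : 0 < K%:R :> R by rewrite ltr0n.
have lnT : 0 <= ln T%:R :> R by rewrite ln_ge0 // ler1n ltnW.
have [n0|n0] := posnP n.
  by rewrite n0 mulr0 mul0r !mulr_ge0 ?addr_ge0 // ltW.
have [small|large] := leqP n (d * K * T.-1).
  have H := query_invariant_ln d0 KR u0 inv.
  have lnn : ln (1 + n%:R / (d%:R * K%:R)) <= ln T%:R :> R.
    rewrite ler_ln ?posrE; last 2 first.
    - by rewrite ltr_pwDl // divr_ge0 ?mulr_ge0 ?ler0n.
    - by rewrite ltr0n ltnW.
    rewrite -lerBrDl ler_pdivrMr ?mulr_gt0 // mulrC -natrM.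
    by rewrite -(natrB _ (ltnW T1)) subn1 -natrM ler_nat.
  have Ku := qi_first inv n0.
  (* After clearing denominators this asks for [K * u <= 2], which [qi_first] provides. *)
  have lnu : K%:R * u <= (K%:R + 1) * ln (1 + u).
    apply: le_trans (_ : (K%:R + 1) * (2 * u / (2 + u)) <= _); last first.
      by rewrite ler_pM2l ?ln1D_ge ?ltW // addr_gt0.
    rewrite mulrA ler_pdivlMr; [nra|lra].
  rewrite mulrAC; apply: le_trans (ler_wpM2r _ lnu) _ => //.
  rewrite -!mulrA ler_pM2l ?addr_gt0 // mulrC; apply: le_trans H _.
  by rewrite ler_pM2l.
have dK1 : (d * K = 1)%N by nia.
have [d1 K1] : d = 1%N /\ K = 1%N by split; nia.
have nT' : n = T by nia.
have := qi_last inv n0 d1; rewrite K1 mul1r nT' d1 => uT.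
by have := all_queried_bound T1 u0 Tu uT; rewrite mul1r mulr1; lra.
Qed.

(** * Counting deletion orders *)

(** Double counting: composing with a transposition shows that the sum is the same for every
    position, and over all [T] positions each permutation meets [C] exactly [#|C|] times. *)
Lemma sum_perm_mem (T : nat) (C : {set 'I_T}) (k : 'I_T) :
  (T * \sum_(s : 'S_T) (s k \in C) = T`! * #|C|)%N.
Proof.
have sumE (j : 'I_T) :
    (\sum_(s : 'S_T) (s j \in C) = \sum_(s : 'S_T) (s k \in C))%N.
  rewrite (reindex_inj (mulgI (tperm j k))) /=.
  by apply: eq_bigr => s _; rewrite permM tpermL.
rewrite -{1}(card_ord T) -sum_nat_const -(eq_bigr _ (fun j _ => sumE j)).
rewrite exchange_big /= -card_Sn -sum_nat_const.
apply: eq_bigr => s _; rewrite -(card_imset _ (@perm_inj _ s^-1)) -sum1_card.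
rewrite [RHS]big_mkcond /=; apply: eq_big => // j _.
suff -> : (j \in [set (s^-1)%g x | x in C]%SET) = (s j \in C) by case: ifP.
by rewrite -{1}(permK s j) mem_imset //; exact: perm_inj.
Qed.

(** Markov's inequality as a count of deletion orders, with denominators cleared: each counted order
    has at least [K.+1] core deletions, and each of the first [m] requests hits the core set in a
    fraction [#|C| / T] of all orders. *)
Lemma card_core_deletions_gt (R : realType) d T K (kappa : R)
    (z : dataset R d T) (p : 'S_T) m :
  (T * (K.+1 * #|[set s : 'S_T | (K < core_deletions K kappa z p s m)%N]%SET|)
    <= m * (T`! * #|core_set K kappa z p|))%N.
Proof.
set C := core_set K kappa z p.
have -> : (m * (T`! * #|C|) = \sum_(k < m) T`! * #|C|)%N.
  by rewrite sum_nat_const card_ord.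
apply: leq_trans
  (_ : T * \sum_(s : 'S_T) core_deletions K kappa z p s m <= _)%N.
  rewrite leq_mul2l; apply/orP; right.
  rewrite mulnC -sum_nat_const big_mkcond leq_sum // => s _.
  by rewrite inE; case: ifP.
under eq_bigr => s _.
  rewrite /core_deletions -sum1_card big_mkcond.
  under eq_bigr => k _ do rewrite inE -/C.
  over.
rewrite exchange_big /= big_distrr /=.
rewrite (bigID (fun k : 'I_T => (k < m)%N)) /=.
rewrite [X in (_ + X)%N]big1 ?addn0; last first.
  move=> k /negbTE km; rewrite big1 ?muln0 // => s _; by rewrite km.
rewrite (eq_bigr (fun=> (T`! * #|C|)%N)); last first.
  move=> k km; rewrite -(sum_perm_mem C k); congr (_ * _)%N.
  by apply: eq_bigr => s _; rewrite km /=; case: ifP.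
rewrite !sum_nat_const card_ord leq_mul2r; apply/orP; right.
(* Since [m] may exceed [T], the indices of ['I_T] below [m] number at most [m], not always [m]. *)
rewrite cardE -(size_map val) -[leqRHS](size_iota 0); apply: uniq_leq_size.
  by rewrite map_inj_uniq ?enum_uniq //; exact: val_inj.
by move=> _ /mapP[k + ->]; rewrite mem_enum mem_iota.
Qed.

(** The factor at [k] is [(1 / T) / (1 - k / T) = 1 / (T - k)]. *)
Lemma wor_prob_uniform (R : realType) T (s : 'S_T) :
  wor_prob (uniform_mass R (T := T)) s = T`!%:R^-1.
Proof.
rewrite /wor_prob /uniform_mass.
have -> : T`! = (\prod_(k < T) (T - k))%N.
  rewrite fact_prod big_add1 /= big_mkord (reindex_inj rev_ord_inj) /=.
  by apply: eq_bigr => k _; rewrite subnSK.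
rewrite natr_prod -prodfV; apply: eq_bigr => k _.
have T0 : T%:R != 0 :> R by rewrite pnatr_eq0 -lt0n (leq_trans _ (ltn_ord k)).
have kT : (T - k)%:R != 0 :> R by rewrite pnatr_eq0 subn_eq0 -ltnNge.
have -> : \sum_(j < T | (j < k)%N) T%:R^-1 = k%:R / T%:R :> R.
  rewrite -(big_ord_widen T (fun=> T%:R^-1) (ltnW (ltn_ord k))).
  by rewrite sumr_const card_ord mulr_natl.
rewrite natrB ?(ltnW (ltn_ord k)) // in kT *.
by field; rewrite kT T0.
Qed.

Lemma card_core_set (R : realType) d T K (kappa : R) (z : dataset R d T)
    (p : 'S_T) :
  #|core_set K kappa z p| = #|(bbq_run K kappa (permute p z)).2|.
Proof.
rewrite /core_set card_imset; last exact: perm_inj.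
by rewrite /bbq_alg; case: (bbq_run _ _ _).
Qed.

(** The dataset and the arrival order are fixed, and only deletion orders are counted. The [K + 1]
    gained from Markov cancels the [K + 1] lost in [query_bound]. *)
Lemma capacity_exhausted_count (R : realType) d T K (kappa c : R)
    (z : dataset R d T) (p : 'S_T) :
  (0 < d)%N -> (1 < T)%N -> (0 < K)%N -> kappa < 1 -> 0 < c ->
  valid_dataset z ->
  #|[set s : 'S_T | (K < core_deletions K kappa z p s
      (total_deletions d T K kappa c))%N]%SET|%:R <= c * T`!%:R.
Proof.
move=> d0 T1 K0 k1 c0 zv; set m := total_deletions _ _ _ _ _.
have := card_core_deletions_gt K kappa z p m.
set N := #|[set s : 'S_T | _]%SET|; rewrite -(ler_nat R) !natrM card_core_set.
have zv' : valid_dataset (permute p z) by move=> t; rewrite tnth_mktuple.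
have := bbq_run_invariant kappa K0 (ltnW T1) zv'.
case: (bbq_run _ _ _) => A Q /= inv.
set u := T%:R `^ (- kappa) in inv.
have TR : 1 < T%:R :> R by rewrite ltr1n.
have u0 : 0 < u by rewrite powR_gt0 // ltr0n ltnW.
(* This is where [kappa < 1] enters. *)
have Tu : T%:R^-1 < u.
  have T0 : 0 < T%:R :> R by lra.
  rewrite -[_^-1]powR_inv1 ?ler0n // -ltr_ln ?posrE;
    [|exact: powR_gt0|exact: u0].
  by rewrite /u !ln_powR ltr_pM2r ?ln_gt0 // ltrN2.
have QT : (#|Q| <= T)%N by rewrite -[leqRHS]card_ord max_card.
have bound := query_bound d0 T1 K0 u0 Tu QT inv.
have dR : 0 < d%:R :> R by rewrite ltr0n.
have lnT : 0 < ln T%:R :> R by rewrite ln_gt0.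
have mle : m%:R <= c * K%:R * T%:R * u / (d%:R * ln T%:R).
  apply: le_trans (_ : c * K%:R * T%:R / (d%:R * T%:R `^ kappa * ln T%:R) <= _).
    rewrite truncn_le divr_ge0 ?mulr_ge0 ?ler0n ?powR_ge0 //; exact: ltW.
  rewrite le_eqVlt; apply/orP; left; apply/eqP; rewrite /u powRN.
  have Tk : T%:R `^ kappa != 0 :> R by rewrite gt_eqF // powR_gt0; lra.
  by field; rewrite Tk !gt_eqF.
move: (T`!%:R) (ler0n R T`!) => F F0 H.
have K1 : 0 < K.+1%:R :> R by rewrite ltr0n.
have T0 : 0 < T%:R :> R by rewrite ltr0n ltnW.
rewrite -(ler_pM2l K1) -(ler_pM2l T0); apply: le_trans H _.
apply: le_trans (ler_wpM2r _ mle) _; first by rewrite mulr_ge0 ?ler0n.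
rewrite mulrAC ler_pdivrMr ?mulr_gt0 //.
have -> : c * K%:R * T%:R * u * (F * #|Q|%:R) =
  (c * T%:R * F) * (K%:R * #|Q|%:R * u) by ring.
have -> : T%:R * (K.+1%:R * (c * F)) * (d%:R * ln T%:R) =
  (c * T%:R * F) * ((K%:R + 1) * d%:R * ln T%:R) by rewrite -natr1; ring.
by rewrite ler_wpM2l // !mulr_ge0 // ltW.
Qed.

(** * Measurability *)

Section Measurability.
Context {disp : measure_display} {V : measurableType disp} {R : realType}.

Lemma measurable_fun_inv (f : V -> R) :
  measurable_fun setT f -> measurable_fun setT (fun v => (f v)^-1).
Proof.
(* Real powers are measurable, but agree with inverses only on nonnegatives. *)
move=> mf.
have -> : (fun v => (f v)^-1) = (fun v => f v * (f v ^+ 2) `^ (-1)).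
  apply/funext => v; rewrite powR_inv1 ?sqr_ge0 // expr2 invfM mulrA.
  have [->|f0] := eqVneq (f v) 0; first by rewrite invr0 mulr0.
  by rewrite mulfV ?mul1r.
apply: measurable_funM => //.
by apply: (measurableT_comp (measurable_powR (-1))); exact: measurable_funX.
Qed.

Definition measurable_mx m n (M : V -> 'M[R]_(m, n)) :=
  forall i j, measurable_fun setT (fun v => M v i j).

Lemma measurable_mxD m n (M N : V -> 'M[R]_(m, n)) :
  measurable_mx M -> measurable_mx N -> measurable_mx (fun v => M v + N v).
Proof.
move=> mM mN i j; under eq_fun do rewrite mxE.
exact: measurable_funD.
Qed.

Lemma measurable_mxsum m n (I : finType) (A : {pred I})
    (M : I -> V -> 'M[R]_(m, n)) :
  (forall i, measurable_mx (M i)) ->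
  measurable_mx (fun v => \sum_(i in A) M i v).
Proof.
move=> mM i j; under eq_fun do rewrite summxE big_mkcond.
apply: measurable_sum => k.
by case: (k \in A); [exact: mM|exact: measurable_cst].
Qed.

Lemma measurable_mxtr m n (M : V -> 'M[R]_(m, n)) :
  measurable_mx M -> measurable_mx (fun v => (M v)^T).
Proof. by move=> mM i j; under eq_fun do rewrite mxE; exact: mM. Qed.

Lemma measurable_mulmx m n p (M : V -> 'M[R]_(m, n)) (N : V -> 'M[R]_(n, p)) :
  measurable_mx M -> measurable_mx N -> measurable_mx (fun v => M v *m N v).
Proof.
move=> mM mN i j; under eq_fun do rewrite mxE.
by apply: measurable_sum => k; apply: measurable_funM; [exact: mM|exact: mN].
Qed.

Lemma measurable_det n (M : V -> 'M[R]_n) :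
  measurable_mx M -> measurable_fun setT (fun v => \det (M v)).
Proof.
move=> mM; apply: measurable_sum => s; apply: measurable_funM => //.
by apply: measurable_prod => i _; exact: mM.
Qed.

Lemma measurable_invmx n (M : V -> 'M[R]_n) :
  measurable_mx M -> measurable_mx (fun v => invmx (M v)).
Proof.
move=> mM i j.
(* Cramer's rule on the invertible matrices; on singular ones [invmx] returns its argument. *)
have -> : (fun v => invmx (M v) i j) = (fun v =>
    if \det (M v) != 0 then (\det (M v))^-1 * \adj (M v) i j else M v i j).
  apply/funext => v; rewrite /invmx unitmxE unitfE.
  by case: ifP => // _; rewrite mxE.
apply: measurable_fun_ifT; last exact: mM.
  apply: measurable_neg; apply: measurable_fun_eqr => //; exact: measurable_det.
apply: measurable_funM.
  by apply: measurable_fun_inv; exact: measurable_det.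
under eq_fun do rewrite mxE /cofactor.
apply: measurable_funM => //; apply: measurable_det => k l.
by under eq_fun do rewrite !mxE; exact: mM.
Qed.

End Measurability.

Section CoreSetMeasurability.
Context {R : realType} {d T : nat}.
Context (K : nat) (kappa : R).

(* The matrix of the run depends on the past only through the queried set, so
   that an event on the run is a finite union over the values of that set. *)
Definition gram (z : dataset R d T) (Q : {set 'I_T}) : 'M[R]_d :=
  K%:R%:M + \sum_(t in Q) Defs.point (tnth z t) *m (Defs.point (tnth z t))^T.

(** The inclusion is carried along so that a newly queried [t] is outside the set and its term
    splits off the sum. *)
Lemma foldl_bbq_gram (z : dataset R d T) (s : seq 'I_T) :
  uniq s ->
  let st := foldl (bbq_step kappa z) (K%:R%:M, finset.set0) s in
  {subset st.2 <= s} /\ st.1 = gram z st.2.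
Proof.
elim/last_ind: s => [|s t IH] /=.
  move=> _; split; first by move=> t; rewrite inE.
  by rewrite /gram big_set0 addr0.
rewrite rcons_uniq foldl_rcons => /andP[ts us].
have [sub E] := IH us; rewrite /bbq_step.
case: ifP => _ /=; last by split=> // t' /sub; rewrite mem_rcons inE orbC => ->.
split=> [t'|].
  by rewrite !inE mem_rcons inE => /orP[->//|/sub ->]; rewrite orbT.
rewrite E /gram -addrA; congr (_ + _); rewrite addrC big_setU1 //=.
by apply: contra ts; exact: sub.
Qed.

Lemma measurable_point t :
  measurable_mx (fun z : dataset R d T => Defs.point (tnth z t)).
Proof.
move=> i j; under eq_fun do rewrite mxE.
apply: (measurableT_comp (measurable_tnth i)).
apply: (measurableT_comp measurable_fst); exact: measurable_tnth.
Qed.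

Lemma measurable_query Q t : measurable_fun setT (fun z : dataset R d T =>
  T%:R `^ (- kappa) <
    ((Defs.point (tnth z t))^T *m invmx (gram z Q) *m
     Defs.point (tnth z t)) 0 0).
Proof.
apply: measurable_fun_ltr => //.
have mp := measurable_point.
apply: measurable_mulmx => //; apply: measurable_mulmx.
  exact: measurable_mxtr.
apply: measurable_invmx; apply: measurable_mxD; first by move=> i j.
apply: measurable_mxsum => k; apply: measurable_mulmx => //.
exact: measurable_mxtr.
Qed.

(** Induction on the last position: the event is split over the set [q'] queried before it. Once
    [q'] is fixed, the query test compares a constant with a measurable function of [z]. *)
Lemma measurable_bbq_positions (q : {set 'I_T}) :
  measurable [set z : dataset R d T | (bbq_run K kappa z).2 = q].
Proof.
have : uniq (enum 'I_T) := enum_uniq _.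
rewrite /bbq_run; elim/last_ind: (enum 'I_T) q => [|s t IH] q /=.
  move=> _; have [->|qn0] := eqVneq finset.set0 q.
    by rewrite (_ : [set _ | _] = setT) //; apply/seteqP; split.
  rewrite (_ : [set _ | _] = set0) //; apply/seteqP; split => // z /= e.
  by rewrite e eqxx in qn0.
move=> us; have := us; rewrite rcons_uniq => /andP[_ us'].
pose cond q' (z : dataset R d T) := T%:R `^ (- kappa) <
    ((Defs.point (tnth z t))^T *m invmx (gram z q') *m
     Defs.point (tnth z t)) 0 0.
have -> :
    [set z | (foldl (bbq_step kappa z) (K%:R%:M, finset.set0)
      (rcons s t)).2 = q] =
    \bigcup_(q' in [set: {set 'I_T}])
      ([set z | (foldl (bbq_step kappa z) (K%:R%:M, finset.set0) s).2 = q'] `&`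
       [set z | (if cond q' z then (t |: q')%SET else q') = q]).
  apply/seteqP; split => z /=; rewrite foldl_rcons.
    have [_ E] := foldl_bbq_gram z us'.
    move=> H.
    exists (foldl (bbq_step kappa z) (K%:R%:M, finset.set0) s).2 => //.
    by split => //=; rewrite /cond -E -H /bbq_step; case: ifP.
  move=> [q' _ [/= q'E H]]; have [_ E] := foldl_bbq_gram z us'.
  by rewrite -H /bbq_step E q'E -/(cond q' z); case: ifP; rewrite //= q'E.
apply: fin_bigcup_measurable; first exact: finite_finset.
move=> q' _; apply: measurableI; first exact: IH.
have mc (b : bool) : measurable [set z | cond q' z = b].
  have := measurable_query q' t measurableT (Y := [set b]).
  by rewrite setTI; exact.
have -> : [set z | (if cond q' z then (t |: q')%SET else q') = q] =
  ([set z | cond q' z = true] `&` [set z | (t |: q')%SET = q]) `|`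
  ([set z | cond q' z = false] `&` [set z | q' = q]).
  apply/seteqP; split => z /=; case: (cond q' z); by intuition.
have mP (Q : Prop) : measurable [set _ : dataset R d T | Q].
  have [HQ|HQ] := pselect Q.
    by rewrite (_ : [set _ | _] = setT) //; apply/seteqP; split.
  by rewrite (_ : [set _ | _] = set0) //; apply/seteqP; split.
by apply: measurableU; apply: measurableI.
Qed.

Lemma measurable_permute p :
  measurable_fun setT (fun z : dataset R d T => permute p z).
Proof.
apply/measurable_fun_tnthP => i.
rewrite [X in measurable_fun _ X](_ : _ =
  (fun z : dataset R d T => tnth z (p i))).
  exact: measurable_tnth.
by apply/funext => z /=; rewrite tnth_mktuple.
Qed.

Lemma measurable_core_deletions_gt p s m : measurable
  [set z : dataset R d T | (K < core_deletions K kappa z p s m)%N].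
Proof.
(* The event depends on [z] only through the queried set of the permuted run; [F] selects the values
   of that set for which it holds. *)
pose F (q : {set 'I_T}) :=
  (K < #|[set k : 'I_T | (k < m)%N && (s k \in [set p t | t in q])]%SET|)%N.
have -> : [set z : dataset R d T | (K < core_deletions K kappa z p s m)%N] =
    \bigcup_(q in [set q | F q])
      [set z | (bbq_run K kappa (permute p z)).2 = q].
  apply/seteqP; split => z /=; rewrite /core_deletions /core_set /bbq_alg.
    case E : (bbq_run _ _ _) => [A Q] /= H.
    by exists Q; [exact: H|rewrite /= E].
  by move=> [q Fq /=]; case: (bbq_run _ _ _) => [A Q] /= ->.
apply: fin_bigcup_measurable; first exact: finite_finset.
move=> q _.
have := measurable_permute p measurableT (measurable_bbq_positions q).
by rewrite setTI.
Qed.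

End CoreSetMeasurability.

(** * The probability of exhausting the capacity *)

Lemma cond_prob_cst (R : realType) (disp dispV : measure_display)
    (Omega : measurableType disp) (V : measurableType dispV)
    (P : probability Omega R) (S : Omega -> V) (E : set Omega) (r : R)
    (B : set V) :
  measurable_fun setT S -> measurable B -> is_cond_prob P S E (fun=> r) ->
  P (S @^-1` B `&` E) = (r%:E * P (S @^-1` B))%E.
Proof.
move=> mS mB [_ ->] //; rewrite integral_cst //.
by rewrite -[S @^-1` B]setTI; exact: mS.
Qed.

(** The event is cut along the finitely many values of [(X, Y)]. Each piece has probability
    [qX * qY] times that of an event on [S], hence is the integral of a multiple of an indicator;
    the sum of the integrands is at most [c] pointwise. *)
Lemma probability_joint_le (R : realType) (disp dispV : measure_display)
    (Omega : measurableType disp) (V : measurableType dispV)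
    (P : probability Omega R) (S : Omega -> V) (I J : finType)
    (X : Omega -> I) (Y : Omega -> J) (qX qY c : R) (E : V -> I -> J -> bool) :
  measurable_fun setT S ->
  cond_law P S X (fun _ _ => qX) -> cond_law P S Y (fun _ _ => qY) ->
  cond_indep P S X Y -> 0 <= qX -> 0 <= qY ->
  (forall i j, measurable [set v | E v i j]) ->
  (forall w, \sum_i \sum_j (E (S w) i j)%:R * (qX * qY) <= c) ->
  (P [set w | E (S w) (X w) (Y w)] <= c%:E)%E.
Proof.
move=> mS lX lY ind qX0 qY0 mE Ec.
pose B (ij : I * J) := [set v | E v ij.1 ij.2].
pose F (ij : I * J) :=
  S @^-1` (B ij) `&` (X @^-1` [set ij.1] `&` Y @^-1` [set ij.2]).
have mB ij : measurable (B ij) by exact: mE.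
have mSB ij : measurable (S @^-1` (B ij)).
  by rewrite -[S @^-1` _]setTI; exact: mS.
have mF ij : measurable (F ij).
  apply: measurableI => //; apply: measurableI; first by case: (lX ij.1).
  by case: (lY ij.2).
have -> : [set w | E (S w) (X w) (Y w)] =
    \bigcup_(ij in [set` enum {: I * J}]) F ij.
  apply/seteqP; split => w /=; last first.
    by move=> [[i j] _ [/= Bw [/= -> ->]]].
  by move=> Ew; exists (X w, Y w); rewrite //= mem_enum.
rewrite measure_fin_bigcup //; last first.
- move=> [i j] [i' j'] _ _ [w [[_ [/= <- <-]] [_ [/= <- <-]]]] //.
have mI ij : measurable_fun setT (fun w => \1_(B ij) (S w) : R).
  by apply: (measurableT_comp _ mS); exact: measurable_indic.
rewrite -fsbig_seq ?enum_uniq //.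
rewrite (eq_bigr (fun ij =>
  \int[P]_w ((\1_(B ij) (S w) * (qX * qY))%:E))%E); last first.
  move=> ij _; have [_ cX] := lX ij.1; have [_ cY] := lY ij.2.
  (* Conditional independence makes the constant [qX * qY] a version of the joint conditional
     probability. *)
  apply: eq_trans (cond_prob_cst mS (mB ij) (ind _ _ _ _ cX cY)) _.
  under eq_integral do rewrite mulrC EFinM.
  rewrite ge0_integralZl_EFin ?mulr_ge0 //; last first.
    exact/measurable_EFinP.
  congr (_ * _)%E.
  under eq_integral => w _ do
    rewrite (_ : \1_(B ij) (S w) = \1_(S @^-1` B ij) w :> R) //.
  by rewrite integral_indic // setIT.
have mf ij : measurable_fun setT (fun w => (\1_(B ij) (S w) * (qX * qY))%:E).
  by apply/measurable_EFinP; exact: measurable_funM.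
have f0 ij w : (0 <= (\1_(B ij) (S w) * (qX * qY))%:E)%E.
  by rewrite lee_fin !mulr_ge0.
rewrite -ge0_integral_sum //.
apply: (@le_trans _ _ (\int[P]_w (cst c%:E w)))%E; last first.
  by rewrite integral_cst // -[X in (_ <= X)%E]mule1 -(probability_setT P) lexx.
apply: ge0_le_integral => //.
- by move=> w _; apply: sume_ge0 => ij _; exact: f0.
- exact: emeasurable_sum.
- move=> w _; rewrite sumEFin lee_fin; apply: le_trans (Ec w).
  rewrite pair_big /= big_enum /= le_eqVlt; apply/orP; left; apply/eqP.
  apply: eq_bigr => ij _; rewrite indicE; congr ((nat_of_bool _)%:R * _).
  by apply/idP/idP; rewrite in_setE.
Qed.

Theorem lemma4p5 (R : realType) (d T K : nat) (kappa c : R)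
  (disp : measure_display) (Omega : measurableType disp)
  (P : probability Omega R)
  (S : {RV P >-> (T.-tuple (d.-tuple R * R))%type})
  (pi sigma : Omega -> 'S_T) :
  (0 < d)%N -> (1 < T)%N -> (1 <= K)%N -> 0 < kappa < 1 -> 0 < c ->
  (forall w, valid_dataset (S w)) ->
  cond_law P S pi (fun _ _ => (T`!)%:R^-1) ->
  cond_law P S sigma (fun s _ => wor_prob (uniform_mass R (T := T)) s) ->
  cond_indep P S pi sigma ->
  (P [set w | (core_deletions K kappa (S w) (pi w) (sigma w)
                 (total_deletions d T K kappa c) > K)%N] <= c%:E)%E.
Proof.
move=> d0 T1 K0 /andP[_ k1] c0 vS lpi lsigma ind.
have lsigma' : cond_law P S sigma (fun _ _ => T`!%:R^-1).
  by move=> s; have := lsigma s; rewrite wor_prob_uniform.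
have F0 : 0 < T`!%:R :> R by rewrite ltr0n fact_gt0.
apply: (probability_joint_le (E := fun z p s =>
  K < core_deletions K kappa z p s (total_deletions d T K kappa c))%N
  _ lpi lsigma' ind).
- exact: measurable_funPT.
- by rewrite invr_ge0 ltW.
- by rewrite invr_ge0 ltW.
- by move=> p s; exact: measurable_core_deletions_gt.
(* Each of the [T!] arrival orders contributes at most [c / T!]. *)
move=> w; apply: le_trans (_ : \sum_(p : 'S_T) c / T`!%:R <= _).
  apply: ler_sum => p _; rewrite -mulr_suml mulrA ler_pM2r ?invr_gt0 //.
  rewrite ler_pdivrMr //.
  apply: le_trans (capacity_exhausted_count p d0 T1 K0 k1 c0 (vS w)).
  rewrite -natr_sum ler_nat -sum1_card [leqRHS]big_mkcond /=.
  by apply: leq_sum => s _; rewrite inE; case: ifP.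
rewrite sumr_const; have -> : #|{: 'S_T}| = T`!.
  by rewrite -card_Sn; apply: eq_card => s; rewrite !inE.
by rewrite -[leLHS]mulr_natr divfK ?gt_eqF.
Qed.
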